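(* Let $n\ge2$, $\Omega=\mathbb{R}^n$, $T>0$ and $\Omega_T=\mathbb{R}^n\times(0,T)$. Suppose that $\phi\in C(\Omega_T\cup(\Omega\times\{0\}))$, $\phi>0$, solves in the viscosity sense $$\Delta_\infty\phi=3\phi^2\phi_t\ \text{ in }\Omega_T,\qquad\phi(x,0)=f(x)\ \text{ for all }x\in\Omega,$$ where $f:\Omega\to(0,\infty)$ is continuous and bounded. Suppose that $h:[0,\infty)\times(0,T)\to(0,\infty)$ is such that $$\frac{\sup_{0<t<T}h(r,t)}{r}=o(1)\quad\text{as }r\to\infty .$$ If $\phi(x,t)\le e^{h(|x|,t)}$ for all $(x,t)\in\Omega_T$, then $$\inf_\Omega f\le\phi(x,t)\le\sup_\Omega f\qquad\text{for all }(x,t)\in\Omega_T .$$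
   Context: $\Delta_\infty\phi=\sum_{i,j}\phi_{x_i}\phi_{x_j}\phi_{x_ix_j}$. $\mathcal S(n)$ is the set of symmetric $n\times n$ real matrices. Semi-jets: for $(y,s)\in\Omega_T$, $(a,p,X)\in\mathbb{R}\times\mathbb{R}^n\times\mathcal S(n)$ belongs to $\mathcal P^+_{\Omega_T}u(y,s)$ if $u(x,t)\le u(y,s)+a(t-s)+\langle p,x-y\rangle+\tfrac12\langle X(x-y),x-y\rangle+o(|t-s|+|x-y|^2)$ as $(x,t)\to(y,s)$ in $\Omega_T$; $\mathcal P^-_{\Omega_T}u=-\mathcal P^+_{\Omega_T}(-u)$. $\Delta_\infty\phi=3\phi^2\phi_t$ in $\Omega_T$ means: $\phi$ is continuous in $\Omega_T$ and, for all $(y,s)\in\Omega_T$, $\langle Xp,p\rangle-3a\,\phi(y,s)^2\ge0$ for all $(a,p,X)\in\mathcal P^+_{\Omega_T}\phi(y,s)$, and $\langle Yq,q\rangle-3b\,\phi(y,s)^2\le0$ for all $(b,q,Y)\in\mathcal P^-_{\Omega_T}\phi(y,s)$. *)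

(* Defs.v *)
From HB Require Import structures.
From mathcomp Require Import all_boot all_order all_algebra.
From mathcomp Require Import all_classical all_reals all_analysis.
Set Implicit Arguments.
Unset Strict Implicit.
Unset Printing Implicit Defensive.
Import Order.TTheory GRing.Theory Num.Theory.
Import numFieldNormedType.Exports.
Local Open Scope classical_set_scope.
Local Open Scope ring_scope.

Definition dot (R : realType) (n : nat) (u v : 'rV[R]_n) : R :=
  \sum_i u 0 i * v 0 i.

(* The Euclidean norm; the library norm `|x| on 'rV[R]_n is the sup norm. *)
Definition enorm (R : realType) (n : nat) (x : 'rV[R]_n) : R :=
  Num.sqrt (dot x x).

(* Vectors are rows, so the quadratic form <X p, p> of a symmetric X is
   dot (p *m X) p. *)
Definition superjet (R : realType) (n : nat) (O : set ('rV[R]_n * R))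
    (u : 'rV[R]_n * R -> R) (z0 : 'rV[R]_n * R) (a : R) (p : 'rV[R]_n)
    (X : 'M[R]_n) : Prop :=
  let F := within O (nbhs z0) in
  X^T = X /\
  exists2 r : 'rV[R]_n * R -> R,
    r =o_F (fun z => `|z.2 - z0.2| + enorm (z.1 - z0.1) ^+ 2) &
    \forall z \near F,
      u z <= u z0 + a * (z.2 - z0.2) + dot p (z.1 - z0.1)
             + 2^-1 * dot ((z.1 - z0.1) *m X) (z.1 - z0.1) + r z.

Definition subjet (R : realType) (n : nat) (O : set ('rV[R]_n * R))
    (u : 'rV[R]_n * R -> R) (z0 : 'rV[R]_n * R) (a : R) (p : 'rV[R]_n)
    (X : 'M[R]_n) : Prop :=
  superjet O (fun z => - u z) z0 (- a) (- p) (- X).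

(* phi solves Delta_infty phi = 3 phi^2 phi_t in O in the viscosity sense. *)
Definition viscosity_solution (R : realType) (n : nat)
    (O : set ('rV[R]_n * R)) (phi : 'rV[R]_n * R -> R) : Prop :=
  {within O, continuous phi} /\
  forall z0, O z0 ->
    (forall a p X, superjet O phi z0 a p X ->
       0 <= dot (p *m X) p - 3 * a * phi z0 ^+ 2) /\
    (forall b q Y, subjet O phi z0 b q Y ->
       dot (q *m Y) q - 3 * b * phi z0 ^+ 2 <= 0).

Definition cylinder (R : realType) (n : nat) (T : R) : set ('rV[R]_n * R) :=
  setT `*` [set t : R | 0 < t < T].
Arguments cylinder {R} n T _.

Definition cylinder0 (R : realType) (n : nat) (T : R) : set ('rV[R]_n * R) :=
  cylinder n T `|` setT `*` [set 0].
Arguments cylinder0 {R} n T _.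

(* Main.v *)
Require Import Defs.
From HB Require Import structures.
From mathcomp Require Import all_boot all_order all_algebra.
From mathcomp Require Import all_classical all_reals all_analysis.
From mathcomp Require Import ring lra.
Set Implicit Arguments.
Unset Strict Implicit.
Unset Printing Implicit Defensive.
Import Order.TTheory GRing.Theory Num.Theory.
Import numFieldNormedType.Exports.
Local Open Scope classical_set_scope.
Local Open Scope ring_scope.

(** The equation is invariant under multiplication of [phi] by positive
    constants, so [phi] can be compared with a barrier [psi] through the
    quotient of the two.  At an interior extremum of that quotient a constant
    multiple of [psi] touches [phi], its Taylor polynomial is a jet of [phi]
    there, and the equation must hold with the derivatives of [psi]; a strict
    barrier makes this impossible.

    Both barriers live on a ball of radius [r] times a time interval [[0, S]]
    with [S < T].  They share the time factor
    [damping S k t = (S - t) / (S - t + k)], which vanishes at [t = S], so that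
    the extremum never sits on the final slice; its logarithmic derivative is
    at most [- k / (S (S + k))], and this fixed rate is what pays for the space
    derivatives.

    - Upper bound ([upper_barrier]): [psi = exp (A |x|^2 / r) / damping].  In
      logarithmic form the space terms are at most a multiple of [A^3], so a
      small [A] depending on [k] gives a strict supersolution whatever [r >= 1].
      On [|x| = r] the barrier is at least [exp (A r)], which beats [phi] because
      [h (r, t) <= A r / 2] for large [r].
    - Lower bound ([lower_barrier]): [psi = (r^2 - |x|^2)^2 * damping], which is
      zero on the lateral boundary, so positivity of [phi] suffices there.  The
      exponent 2 makes the infinity-Laplacian of [psi] positive near the lateral
      boundary, and in the rest of the ball the relative defect is of order [r^-4].

    Letting [r] go to infinity and then [k] to 0 makes both normalised barriers tend
    to 1 at any given point, which gives the two inequalities.  The jets of both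
    barriers come from [superjet_radial_hyperbolic], and the extremum from
    [interior_maximum]. *)

(** * The Euclidean structure on row vectors *)

Section euclidean.
Context (R : realType) (n : nat).
Implicit Types (x y d : 'rV[R]_n).

Lemma dotC x y : dot x y = dot y x.
Proof. by apply: eq_bigr => i _; rewrite mulrC. Qed.

Lemma dotDl x y d : dot (x + y) d = dot x d + dot y d.
Proof.
by rewrite /dot -big_split /=; apply: eq_bigr => i _; rewrite mxE mulrDl.
Qed.

Lemma dotZl (a : R) x y : dot (a *: x) y = a * dot x y.
Proof.
by rewrite /dot big_distrr /=; apply: eq_bigr => i _; rewrite mxE mulrA.
Qed.

Lemma dotZr (a : R) x y : dot x (a *: y) = a * dot x y.
Proof. by rewrite dotC dotZl dotC. Qed.

Lemma dotDr x y d : dot d (x + y) = dot d x + dot d y.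
Proof. by rewrite dotC dotDl !(dotC d). Qed.

Lemma dot_ge0 x : 0 <= dot x x.
Proof. by apply: sumr_ge0 => i _; rewrite -expr2 sqr_ge0. Qed.

Lemma enorm_ge0 x : 0 <= enorm x.
Proof. exact: sqrtr_ge0. Qed.

Lemma sqr_enorm x : enorm x ^+ 2 = dot x x.
Proof. by rewrite sqr_sqrtr // dot_ge0. Qed.

Lemma dot_sqD y d : dot (y + d) (y + d) = dot y y + (2 * dot y d + dot d d).
Proof. by rewrite !dotDl !dotDr (dotC d y); ring. Qed.

Lemma cauchy_schwarz x y : `|dot x y| <= enorm x * enorm y.
Proof.
rewrite -[leRHS]ger0_norm ?mulr_ge0 ?enorm_ge0// -ler_sqr ?nnegrE//.
rewrite !real_normK ?num_real// exprMn !sqr_enorm.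
have [y0|y0] := eqVneq (dot y y) 0.
  have -> : dot x y = 0; last by rewrite expr0n /= mulr_ge0 ?dot_ge0.
  have sq_ge0 (i : 'I_n) : true -> 0 <= y 0 i * y 0 i.
    by rewrite -expr2 sqr_ge0.
  apply: big1 => i _; have /eqP := @psumr_eq0P _ _ _ _ sq_ge0 y0 i isT.
  by rewrite mulf_eq0 orbb => /eqP ->; rewrite mulr0.
have ypos : 0 < dot y y by rewrite lt_neqAle eq_sym y0 dot_ge0.
have := dot_ge0 (dot y y *: x - dot x y *: y).
rewrite -scaleNr !dotDl !dotDr !dotZl !dotZr (dotC y x).
set a := dot y y; set b := dot x y; set c := dot x x => H.
rewrite -(ler_pM2l ypos) -/a; lra.
Qed.

Lemma coord_le_enorm (x : 'rV[R]_n) i : `|x 0 i| <= enorm x.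
Proof.
rewrite -[leRHS]ger0_norm ?enorm_ge0// -ler_sqr ?nnegrE//.
rewrite !real_normK ?num_real// sqr_enorm /dot (bigD1 i)//= -expr2 lerDl.
by apply: sumr_ge0 => j _; rewrite -expr2 sqr_ge0.
Qed.

Lemma continuous_dot : continuous (fun x => dot x x).
Proof.
rewrite /dot; elim: (index_enum _) => [|i s IHs] x.
  rewrite [X in continuous_at _ X](_ : _ = cst 0); first exact: cst_continuous.
  by apply/funext => z; rewrite big_nil.
rewrite [X in continuous_at _ X](_ : _ =
    fun z : 'rV[R]_n => z 0 i * z 0 i + \sum_(j <- s) z 0 j * z 0 j); last first.
  by apply/funext => z; rewrite big_cons.
apply: (@continuousD _ _ _ (fun z : 'rV[R]_n => z 0 i * z 0 i)); last exact: IHs.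
by apply: continuousM; exact: coord_continuous.
Qed.

Lemma continuous_sqnorm (z : 'rV[R]_n * R) :
  (fun w : 'rV[R]_n * R => dot w.1 w.1) w @[w --> z] --> dot z.1 z.1.
Proof.
apply: (cvg_comp (fun w : 'rV[R]_n * R => w.1) (fun x => dot x x)).
  exact: cvg_fst.
exact: continuous_dot.
Qed.

Lemma dot_quadratic (a b : R) x y :
  dot (x *m (a *: 1%:M + b *: (y^T *m y))) x = a * dot x x + b * dot y x ^+ 2.
Proof.
rewrite mulmxDr -!scalemxAr mulmx1 dotDl !dotZl mulmxA; congr (_ + b * _).
have -> : x *m y^T = (dot x y)%:M.
  apply/matrixP => i j; rewrite !ord1 !mxE eqxx mulr1n.
  by apply: eq_bigr => k _; rewrite mxE.
by rewrite mul_scalar_mx dotZl (dotC x).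
Qed.
End euclidean.

(** * Jets of radial functions *)

(** The product of a quadratic polynomial in the increment [s = 2 b + D^2] of
    the squared norm and of a function of time, minus its part of parabolic
    order at most two.  What is left is bounded by [(|t| + D) (|t| + D^2)],
    one order better than the weight [|t| + D^2] of the jets. *)
Lemma remainder_bound (R : realFieldType) (P0 P1 P2 Q0 Q1 C Y S D b s t e : R) :
  0 <= C -> 0 <= Y -> 0 <= D <= 1 -> `|t| <= 1 -> `|b| <= Y * D ->
  `|e| <= C * t ^+ 2 ->
  s = 2 * b + D ^+ 2 -> S = 2 * Y + 1 ->
  `|P0 * e + (P1 * s + P2 * s ^+ 2) * (Q1 * t + e)
     + Q0 * P2 * (4 * b * D ^+ 2 + D ^+ 4)|
  <= (`|P0| * C + (`|P1| * S + `|P2| * S ^+ 2) * (`|Q1| + C)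
      + `|Q0 * P2| * (4 * Y + 1)) * ((`|t| + D) * (`|t| + D ^+ 2)).
Proof.
move=> C0 Y0 /andP[D0 D1] t1 hb he.
have tn : t ^+ 2 = `|t| ^+ 2 by rewrite real_normK ?num_real.
rewrite tn in he.
pose T := `|t|; rewrite -/T in t1 he.
move=> sE SE; rewrite -/T.
have T0 : 0 <= T by exact: normr_ge0.
have S0 : 0 <= S by rewrite SE; lra.
have hs : `|s| <= S * D.
  rewrite sE (le_trans (ler_normD _ _))// normrM (ger0_norm (sqr_ge0 D)).
  by rewrite ger0_norm// SE; nra.
set M := (T + D) * (T + D ^+ 2).
have DD : 0 <= D ^+ 2 <= D by rewrite expr2 mulr_ge0//= ler_piMr.
have M0 : 0 <= M by rewrite /M mulr_ge0 ?addr_ge0// ?sqr_ge0.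
have MT : T ^+ 2 <= M by rewrite /M; nra.
have MTD : D * T <= M by rewrite /M; nra.
have MD : D ^+ 3 <= M.
  have -> : D ^+ 3 = D * D ^+ 2 by ring.
  by rewrite /M; nra.
have h1 : `|P0 * e| <= `|P0| * C * M.
  by rewrite normrM -mulrA ler_wpM2l// (le_trans he)// ler_wpM2l.
have h2 : `|P1 * s + P2 * s ^+ 2| <= (`|P1| * S + `|P2| * S ^+ 2) * D.
  rewrite (le_trans (ler_normD _ _))// (normrM P1) (normrM P2) mulrDl lerD//.
    by rewrite -mulrA ler_wpM2l.
  rewrite -mulrA ler_wpM2l// normrX.
  rewrite (le_trans (lerXn2r 2 _ _ hs)) ?nnegrE ?mulr_ge0//.
  by rewrite exprMn ler_wpM2l ?sqr_ge0//; case/andP: DD.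
have h3 : `|Q1 * t + e| <= (`|Q1| + C) * T.
  rewrite (le_trans (ler_normD _ _))// normrM -/T mulrDl lerD// (le_trans he)//.
  by rewrite ler_wpM2l// expr2 ler_piMr.
have h23 : `|(P1 * s + P2 * s ^+ 2) * (Q1 * t + e)|
    <= (`|P1| * S + `|P2| * S ^+ 2) * (`|Q1| + C) * M.
  rewrite normrM (le_trans (ler_pM _ _ h2 h3))//.
  rewrite mulrACA ler_wpM2l// mulr_ge0 ?addr_ge0 ?mulr_ge0 ?sqr_ge0//.
have h4 : `|4 * b * D ^+ 2 + D ^+ 4| <= (4 * Y + 1) * M.
  have -> : 4 * b * D ^+ 2 + D ^+ 4 = (4 * b + D ^+ 2) * D ^+ 2 by ring.
  have h5 : `|4 * b + D ^+ 2| <= (4 * Y + 1) * D.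
    rewrite (le_trans (ler_normD _ _))// normrM (ger0_norm (sqr_ge0 D)).
    by rewrite ger0_norm//; nra.
  rewrite normrM (ger0_norm (sqr_ge0 D)).
  rewrite (le_trans (ler_wpM2r (sqr_ge0 D) h5))//.
  by rewrite -mulrA -exprS ler_wpM2l//; lra.
rewrite (le_trans (ler_normD _ _))// [leRHS]mulrDl lerD//.
  by rewrite (le_trans (ler_normD _ _))// [leRHS]mulrDl lerD.
by rewrite normrM -[leRHS]mulrA ler_wpM2l.
Qed.

Section jets.
Context (R : realType) (n : nat).
Implicit Types (O : set ('rV[R]_n * R)) (y : 'rV[R]_n).

Lemma near_space y (t0 r : R) : 0 < r ->
  \forall z \near nbhs (y, t0), enorm (z.1 - y) < r.
Proof.
move=> r0.
have cts : (fun z : 'rV[R]_n * R => dot (z.1 - y) (z.1 - y)) z @[z --> (y, t0)]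
    --> dot (y - y) (y - y).
  apply: (cvg_comp (fun z : 'rV[R]_n * R => z.1 - y) (fun x => dot x x)).
    by apply: cvgB; [exact: cvg_fst|exact: cvg_cst].
  exact: continuous_dot.
have r2 : dot (y - y) (y - y) < r ^+ 2.
  by rewrite subrr /dot big1 ?exprn_gt0// => i _; rewrite mxE mul0r.
near=> z; rewrite -ltr_sqr ?nnegrE ?enorm_ge0 ?ltW// sqr_enorm.
by near: z; exact: cvgr_lt cts _ r2.
Unshelve. all: by end_near. Qed.

Lemma near_time y (t0 r : R) : 0 < r ->
  \forall z \near nbhs (y, t0), `|z.2 - t0| < r.
Proof.
move=> r0; have cts : z.2 @[z --> (y, t0)] --> t0 by exact: cvg_snd.
near=> z; rewrite distrC; near: z; exact: cvgr_dist_lt.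
Unshelve. all: by end_near. Qed.

(** The coefficients are those of the second-order expansion: the increment of
    [|x|^2] at [y] in direction [d] is [2 <y, d> + |d|^2], so [P1] enters both
    the gradient and the Hessian.  An inequality is enough on the space side;
    [e] is the second-order error on the time side. *)
Lemma superjet_radial_product O u y (t0 P0 P1 P2 Q0 Q1 C : R) (e : R -> R) :
  0 <= C ->
  (\forall z \near nbhs (y, t0), `|e z.2| <= C * (z.2 - t0) ^+ 2) ->
  u (y, t0) = P0 * Q0 ->
  (\forall z \near within O (nbhs (y, t0)),
    u z <= (P0 + P1 * (dot z.1 z.1 - dot y y)
               + P2 * (dot z.1 z.1 - dot y y) ^+ 2)
           * (Q0 + Q1 * (z.2 - t0) + e z.2)) ->
  superjet O u (y, t0) (P0 * Q1) ((2 * Q0 * P1) *: y)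
    ((2 * Q0 * P1) *: 1%:M + (8 * Q0 * P2) *: (y^T *m y)).
Proof.
move=> C0 he u0 hu; split.
  by rewrite linearD !linearZ /= trmx1 trmx_mul trmxK.
pose s (z : 'rV[R]_n * R) := dot z.1 z.1 - dot y y.
pose b (z : 'rV[R]_n * R) := dot y (z.1 - y).
pose D (z : 'rV[R]_n * R) := enorm (z.1 - y).
have sE z : s z = 2 * b z + D z ^+ 2.
  by rewrite /s -[in LHS](subrKC y z.1) dot_sqD [LHS]addrC addKr -sqr_enorm.
pose r z := P0 * e z.2
  + (P1 * s z + P2 * s z ^+ 2) * (Q1 * (z.2 - t0) + e z.2)
  + Q0 * P2 * (4 * b z * D z ^+ 2 + D z ^+ 4).
(* r is exactly the given product minus the quadratic model. *)
exists r; last first.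
  near=> z.
  have -> : u (y, t0) + P0 * Q1 * (z.2 - (y, t0).2) +
      dot ((2 * Q0 * P1) *: y) (z.1 - (y, t0).1) +
      2^-1 * dot ((z.1 - (y, t0).1) *m
        ((2 * Q0 * P1) *: 1%:M + (8 * Q0 * P2) *: (y^T *m y)))
        (z.1 - (y, t0).1) + r z =
     (P0 + P1 * s z + P2 * s z ^+ 2) * (Q0 + Q1 * (z.2 - t0) + e z.2).
    rewrite u0 /= dot_quadratic dotZl -sqr_enorm -/(b z) -/(D z) /r sE.
    by field.
  by near: z.
pose K := `|P0| * C + (`|P1| * (2 * enorm y + 1)
   + `|P2| * (2 * enorm y + 1) ^+ 2) * (`|Q1| + C)
   + `|Q0 * P2| * (4 * enorm y + 1).
have K0 : 0 <= K.
  by rewrite /K !addr_ge0 ?mulr_ge0 ?addr_ge0 ?mulr_ge0 ?enorm_ge0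
     ?exprn_ge0 ?addr_ge0 ?mulr_ge0 ?enorm_ge0.
apply/eqoP => eps eps0.
(* For z within d of (y, t0) the factor |t| + D of the bound on r is at most
   2 d, and d is chosen so that K * 2 d <= eps. *)
have d0 : 0 < Num.min 1 (eps / (2 * (K + 1))).
  by rewrite lt_min ltr01 /= divr_gt0// mulr_gt0// ltr_wpDl.
set d := Num.min _ _ in d0.
apply: cvg_within; near=> z.
have hD : D z < d by near: z; exact: near_space.
have ht : `|z.2 - t0| < d by near: z; exact: near_time.
have D0 : 0 <= D z by exact: enorm_ge0.
have [d1 d2] : d <= 1 /\ d * (2 * (K + 1)) <= eps.
  split; first by rewrite ge_min lexx.
  by rewrite -ler_pdivlMr ?mulr_gt0 ?ltr_wpDl// ge_min lexx orbT.
have hr : `|r z| <= K * ((`|z.2 - t0| + D z) * (`|z.2 - t0| + D z ^+ 2)).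
  apply: remainder_bound => //; first exact: enorm_ge0.
  - by rewrite D0 (le_trans (ltW hD)).
  - by rewrite (le_trans (ltW ht)).
  - exact: cauchy_schwarz.
  - by near: z.
rewrite /= -/(D z) [X in _ <= _ * X]ger0_norm ?addr_ge0 ?sqr_ge0//.
rewrite (le_trans hr)// mulrA ler_wpM2r ?addr_ge0 ?sqr_ge0//.
have hs : `|z.2 - t0| + D z <= d * 2 by lra.
by rewrite (le_trans (ler_wpM2l K0 hs))//; nra.
Unshelve. all: by end_near. Qed.
End jets.

Section touching.
Context (R : realType) (n : nat).
Implicit Types (O : set ('rV[R]_n * R)) (y : 'rV[R]_n).

Lemma inv_second_order (a t : R) : 0 < a -> `|t| < a / 2 ->
  `|(a - t)^-1 - a^-1 - t / a ^+ 2| <= 2 / a ^+ 3 * t ^+ 2.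
Proof.
move=> a0; rewrite ltr_norml => /andP[ht1 ht2].
have at0 : 0 < a - t by lra.
have -> : (a - t)^-1 - a^-1 - t / a ^+ 2 = t ^+ 2 * (a ^+ 2 * (a - t))^-1.
  by field; rewrite !gt_eqF.
have d0 : 0 < a ^+ 2 * (a - t) by rewrite mulr_gt0// exprn_gt0.
rewrite ger0_norm; last by rewrite mulr_ge0 ?sqr_ge0// invr_ge0 ltW.
rewrite mulrC ler_wpM2r ?sqr_ge0//.
rewrite -[2]invrK -invfM lef_pV2 ?posrE// ?mulr_gt0 ?invr_gt0 ?exprn_gt0//.
by rewrite exprSr mulrCA ler_wpM2l ?sqr_ge0//; lra.
Qed.

(** Both the damping factor and its inverse are, up to normalisation, of the
    form [1 - k / (c - t0) + k / (c - t)], so this one family of time factors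
    serves the two barriers. *)
Lemma superjet_radial_hyperbolic O u y (t0 P0 P1 P2 k c : R) :
  t0 < c -> u (y, t0) = P0 ->
  (\forall z \near within O (nbhs (y, t0)),
    u z <= (P0 + P1 * (dot z.1 z.1 - dot y y)
               + P2 * (dot z.1 z.1 - dot y y) ^+ 2)
           * (1 - k / (c - t0) + k / (c - z.2))) ->
  superjet O u (y, t0) (P0 * (k / (c - t0) ^+ 2)) ((2 * P1) *: y)
    ((2 * P1) *: 1%:M + (8 * P2) *: (y^T *m y)).
Proof.
move=> tc u0 hu; have a0 : 0 < c - t0 by rewrite subr_gt0.
pose e t := k * ((c - t)^-1 - (c - t0)^-1 - (t - t0) / (c - t0) ^+ 2).
have := @superjet_radial_product R n O u y t0 P0 P1 P2 1 (k / (c - t0) ^+ 2)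
  (`|k| * (2 / (c - t0) ^+ 3)) e.
rewrite !mulr1; apply => //.
- by rewrite mulr_ge0// divr_ge0// exprn_ge0// ltW.
- near=> z; rewrite /e normrM -mulrA ler_wpM2l//.
  have -> : c - z.2 = c - t0 - (z.2 - t0) by ring.
  apply: inv_second_order => //.
  by near: z; apply: near_time; rewrite divr_gt0.
- near=> z.
  have -> : 1 + k / (c - t0) ^+ 2 * (z.2 - t0) + e z.2 =
     1 - k / (c - t0) + k / (c - z.2) by rewrite /e; ring.
  by near: z.
Unshelve. all: by end_near. Qed.

Lemma quadratic_form_radial y (P1 P2 : R) :
  dot (((2 * P1) *: y) *m ((2 * P1) *: 1%:M + (8 * P2) *: (y^T *m y)))
      ((2 * P1) *: y) = 8 * P1 ^+ 2 * dot y y * (P1 + 4 * P2 * dot y y).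
Proof. by rewrite dot_quadratic dotZl !dotZr; ring. Qed.

(** The viscosity inequality read off a touching function of the above form.
    The cubes of [phi] reflect the homogeneity of the equation: [P1] and [P2]
    will be multiples of [phi (y, t0)], which then cancels. *)
Lemma viscosity_touch_above O phi y (t0 P1 P2 k c : R) :
  viscosity_solution O phi -> O (y, t0) -> t0 < c ->
  (\forall z \near nbhs (y, t0),
    phi z <= (phi (y, t0) + P1 * (dot z.1 z.1 - dot y y)
               + P2 * (dot z.1 z.1 - dot y y) ^+ 2)
           * (1 - k / (c - t0) + k / (c - z.2))) ->
  3 * phi (y, t0) ^+ 3 * (k / (c - t0) ^+ 2)
    <= 8 * P1 ^+ 2 * dot y y * (P1 + 4 * P2 * dot y y).
Proof.
move=> [_ sol] Oz tc hu; have [sup _] := sol _ Oz.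
have := @superjet_radial_hyperbolic O phi y t0 (phi (y, t0)) P1 P2 k c tc erefl.
move=> /(_ (cvg_within _ hu)) /sup; rewrite quadratic_form_radial subr_ge0.
by apply: le_trans; rewrite le_eqVlt; apply/orP; left; apply/eqP; ring.
Qed.

Lemma viscosity_touch_below O phi y (t0 P1 P2 k c : R) :
  viscosity_solution O phi -> O (y, t0) -> t0 < c ->
  (\forall z \near nbhs (y, t0),
    (phi (y, t0) + P1 * (dot z.1 z.1 - dot y y)
               + P2 * (dot z.1 z.1 - dot y y) ^+ 2)
           * (1 - k / (c - t0) + k / (c - z.2)) <= phi z) ->
  8 * P1 ^+ 2 * dot y y * (P1 + 4 * P2 * dot y y)
    <= 3 * phi (y, t0) ^+ 3 * (k / (c - t0) ^+ 2).
Proof.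
move=> [_ sol] Oz tc hu; have [_ sub] := sol _ Oz.
set X := (2 * P1) *: 1%:M + (8 * P2) *: (y^T *m y).
have := @superjet_radial_hyperbolic O (fun z => - phi z) y t0 (- phi (y, t0))
  (- P1) (- P2) k c tc erefl.
have -> : (2 * - P1) *: 1%:M + (8 * - P2) *: (y^T *m y) = - X.
  by rewrite /X !mulrN !scaleNr opprD.
rewrite mulrN scaleNr mulNr.
have hu' : \forall z \near within O (nbhs (y, t0)), - phi z <=
    (- phi (y, t0) - P1 * (dot z.1 z.1 - dot y y)
               - P2 * (dot z.1 z.1 - dot y y) ^+ 2)
           * (1 - k / (c - t0) + k / (c - z.2)).
  apply: cvg_within; near=> z; rewrite lerNl -mulNr !opprD !opprK.
  by near: z.
move=> /(_ _)/sub.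
rewrite quadratic_form_radial subr_le0 => H.
have {}H := H _; apply: le_trans (H _) _.
  by apply: filterS hu' => z; rewrite !mulNr.
by rewrite le_eqVlt; apply/orP; left; apply/eqP; ring.
Unshelve. all: by end_near. Qed.

End touching.

(** * The time factor of the barriers *)

Section damping.
Context (R : realType).

Definition damping (S k t : R) : R := (S - t) / (S - t + k).

Lemma damping_end (S k : R) : damping S k S = 0.
Proof. by rewrite /damping subrr mul0r. Qed.

Lemma damping_ge0 (S k t : R) : 0 < k -> t <= S -> 0 <= damping S k t.
Proof. by move=> k0 tS; apply: divr_ge0; lra. Qed.

Lemma damping_gt0 (S k t : R) : 0 < k -> t < S -> 0 < damping S k t.
Proof. by move=> k0 tS; apply: divr_gt0; lra. Qed.

Lemma damping_le1 (S k t : R) : 0 < k -> t <= S -> damping S k t <= 1.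
Proof.
move=> k0 tS; have d0 : 0 < S - t + k by rewrite ltr_wpDl ?subr_ge0.
by rewrite ler_pdivrMr// mul1r lerDl ltW.
Qed.

Lemma damping_continuous (S k t : R) : 0 < k -> t <= S ->
  {for t, continuous (damping S k)}.
Proof.
move=> k0 tS; have d0 : S - t + k != 0.
  by rewrite gt_eqF// ltr_wpDl ?subr_ge0.
have cS : (fun u : R => S - u) u @[u --> t] --> S - t.
  by apply: cvgB; [exact: cvg_cst|exact: cvg_id].
have cSk : (fun u : R => S - u + k) u @[u --> t] --> S - t + k.
  by apply: cvgD; [exact: cS|apply: cvg_cst].
exact: cvgM cS (cvgV d0 cSk).
Qed.

(** The right-hand side is minus the logarithmic derivative of [damping S k] at
    [t]: the gain in time is bounded below uniformly in [t]. *)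
Lemma damping_rate (S k t : R) : 0 < k -> 0 < t < S ->
  k / (S * (S + k)) <= k / ((S - t) * (S - t + k)).
Proof.
move=> k0 /andP[t0 tS]; have a0 : 0 < S - t by lra.
have S0 : 0 < S by lra.
have d0 : 0 < (S - t) * (S - t + k) by apply: mulr_gt0; lra.
rewrite (ler_wpM2l (ltW k0))// lef_pV2 ?posrE//; last by apply: mulr_gt0; lra.
by apply: ler_pM; lra.
Qed.

Lemma damping_ratio (S k t0 t : R) : 0 < k -> t0 < S -> t < S ->
  damping S k t0 / damping S k t =
  1 - (S - t0) * k / (S - t0 + k) / (S - t0)
    + (S - t0) * k / (S - t0 + k) / (S - t).
Proof.
move=> k0 t0S tS; rewrite /damping; field.
by apply/and3P; split; rewrite gt_eqF//; lra.
Qed.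

Lemma damping_ratioV (S k t0 t : R) : 0 < k -> t0 < S -> t < S ->
  damping S k t / damping S k t0 =
  1 - - ((S - t0 + k) / (S - t0) * k) / (S + k - t0)
    + - ((S - t0 + k) / (S - t0) * k) / (S + k - t).
Proof.
move=> k0 t0S tS; rewrite /damping; field.
by do ?[apply/andP; split]; rewrite gt_eqF//; lra.
Qed.

(** The sharp coefficient is 1/2; the slack in the strict inequality for the
    upper barrier absorbs the loss, and the bound has no remainder term. *)
Lemma expR_quadratic (x : R) : x <= 1 / 2 -> expR x <= 1 + x + 2 * x ^+ 2.
Proof.
move=> hx; have x1 : 0 < 1 - x by lra.
have -> : expR x = (expR (- x))^-1 by rewrite expRN invrK.
apply: (@le_trans _ _ (1 - x)^-1).
  by rewrite lef_pV2 ?posrE ?expR_gt0//; exact: expR_ge1Dx.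
rewrite -[leLHS]mul1r ler_pdivrMr//.
by have := sqr_ge0 x; nra.
Qed.
End damping.

(** * Interior maxima on a parabolic cylinder *)

Section maximum.
Context (R : realType) (n : nat).

Definition ball_cylinder (r S : R) : set ('rV[R]_n * R) :=
  [set z | dot z.1 z.1 <= r ^+ 2 /\ 0 <= z.2 <= S].

Lemma ball_cylinder_compact (r S : R) : 0 <= r ->
  compact (ball_cylinder r S).
Proof.
move=> r0.
have -> : ball_cylinder r S =
    [set x : 'rV[R]_n | dot x x <= r ^+ 2] `*` [set` `[0, S]].
  by apply/seteqP; split => -[x t] /=; rewrite /ball_cylinder /= in_itv.
apply: compact_setX; last exact: segment_compact.
pose A := [set v : 'rV[R]_n | forall i, [set` `[- r, r]] (v ord0 i)].
apply: (@subclosed_compact _ _ A).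
- apply: (preimage_closed (f := fun x : 'rV[R]_n => dot x x)
    (D := [set u | u <= r ^+ 2])); last exact: closed_le.
  by move=> x _; exact: continuous_dot.
- apply: (@rV_compact _ n (fun=> [set` `[- r, r]])) => i.
  exact: segment_compact.
- move=> x /= xr i /=; rewrite in_itv /= -ler_norml.
  rewrite (le_trans (coord_le_enorm x i))//.
  by rewrite -ler_sqr ?nnegrE ?enorm_ge0// sqr_enorm.
Qed.

(** The final slice [t = S] is treated as part of the boundary.  The maximum is
    then local in full neighbourhoods, as two-sided jets in time require. *)
Lemma interior_maximum (g : 'rV[R]_n * R -> R) (r S B : R) z0 : 0 <= r ->
  {within ball_cylinder r S, continuous g} ->
  (forall z, ball_cylinder r S z ->
     z.2 = 0 \/ z.2 = S \/ dot z.1 z.1 = r ^+ 2 -> g z <= B) ->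
  ball_cylinder r S z0 -> B < g z0 ->
  exists z1, [/\ dot z1.1 z1.1 < r ^+ 2, 0 < z1.2 < S &
    \forall z \near nbhs z1, ball_cylinder r S z /\ g z <= g z1].
Proof.
move=> r0 gc gB Kz0 Bg.
have [|z1 /set_mem Kz1 maxz1] :=
  compact_EVT_max _ (ball_cylinder_compact r0) gc; first by exists z0.
have Bg1 : B < g z1 by rewrite (lt_le_trans Bg)// maxz1// inE.
have nb : ~ (z1.2 = 0 \/ z1.2 = S \/ dot z1.1 z1.1 = r ^+ 2).
  by move=> /(gB _ Kz1); rewrite leNgt Bg1.
case: (Kz1) => hr /andP[h0 hS].
have hr' : dot z1.1 z1.1 < r ^+ 2.
  by rewrite lt_neqAle hr andbT; apply/eqP => ?; apply: nb; right; right.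
have h0' : 0 < z1.2.
  by rewrite lt_neqAle h0 andbT eq_sym; apply/eqP => ?; apply: nb; left.
have hS' : z1.2 < S.
  by rewrite lt_neqAle hS andbT; apply/eqP => ?; apply: nb; right; left.
exists z1; split => //; first by rewrite h0' hS'.
have c1 := @continuous_sqnorm R n z1.
have c2 : z.2 @[z --> z1] --> z1.2 by exact: cvg_snd.
near=> z.
have Kz : ball_cylinder r S z.
  split; first by apply: ltW; near: z; exact: cvgr_lt c1 _ hr'.
  apply/andP; split; apply: ltW; near: z.
    exact: cvgr_gt c2 _ h0'.
  exact: cvgr_lt c2 _ hS'.
by split => //; apply: maxz1; rewrite inE.
Unshelve. all: by end_near. Qed.
End maximum.

(** * Growth and limits *)

Lemma sublinear_bound (R : realType) (T : R) (h : R -> R -> R) :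
  (ereal_sup [set (h r t)%:E | t in [set t : R | (0 < t < T)%R]] * (r^-1)%:E)%E
       @[r --> +oo%R] --> 0%E ->
  forall eps, 0 < eps -> exists r0, forall r t, r0 <= r -> 0 < t < T ->
    h r t <= eps * r.
Proof.
move=> hg eps eps0.
have : \forall r \near +oo, (ereal_sup [set (h r t)%:E | t in
    [set t : R | (0 < t < T)%R]] * (r^-1)%:E < eps%:E)%E.
  apply: (hg [set u | (u < eps%:E)%E]).
  by apply: open_ereal_lt'; rewrite lte_fin.
move=> [M [_ hM]]; exists (Num.max 1 (M + 1)) => r t.
rewrite ge_max => /andP[r1 rM] tT.
have r0 : 0 < r by lra.
have /hM /ltW : M < r by lra.
rewrite lee_pdivrMr// -EFinM => H.
rewrite -lee_fin; apply: le_trans H; apply: ereal_sup_ubound.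
by exists t.
Qed.

Lemma le_of_asymptotic_le (R : realFieldType) (c d M r1 : R) :
  (forall r, r1 <= r -> 0 < r -> c - d / r <= M) -> c <= M.
Proof.
move=> H; rewrite leNgt; apply/negP => Mc.
have cM : 0 < c - M by rewrite subr_gt0.
pose r := Num.max r1 (Num.max 1 ((`|d| + 1) / (c - M))).
have rr1 : r1 <= r by rewrite le_max lexx.
have rr2 : 1 <= r by rewrite !le_max lexx orbT.
have rr3 : (`|d| + 1) / (c - M) <= r by rewrite !le_max lexx !orbT.
have r0 : 0 < r by lra.
have := H _ rr1 r0; rewrite leNgt => /negP; apply.
rewrite ltrBrDl -ltrBrDr ltr_pdivrMr// mulrC.
by move: rr3; rewrite ler_pdivrMr// => rr3; have := ler_norm d; lra.
Qed.

(** With [a = S - t] the factor is [damping S k t], so this is the limit of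
    vanishing damping. *)
Lemma le_of_damped_le (R : realType) (a c M : R) : 0 < a -> 0 <= M ->
  (forall k, 0 < k -> c * (a / (a + k)) <= M) -> c <= M.
Proof.
move=> a0 M0 H; rewrite -(ler_pM2r a0).
apply: (@le_of_asymptotic_le R _ M _ 1) => r r1 r0.
have := H r^-1; rewrite invr_gt0 => /(_ r0).
rewrite mulrA ler_pdivrMr ?addr_gt0 ?invr_gt0//.
by rewrite lerBlDr mulrDr.
Qed.

(** * The two barriers *)

Section barriers.
Context (R : realType) (n : nat) (T : R) (phi : 'rV[R]_n * R -> R).
Context (phi_cont : {within cylinder0 n T, continuous phi}).
Context (phi_gt0 : forall z, cylinder0 n T z -> 0 < phi z).
Context (phi_sol : viscosity_solution (cylinder n T) phi).

Lemma ball_cylinderS (r S : R) : S < T ->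
  ball_cylinder r S `<=` cylinder0 n T.
Proof.
move=> ST [x t] [_] /= /andP[t0 tS].
have [<-|tn0] := eqVneq 0 t; first by right.
by left; split => //=; rewrite lt_neqAle tn0 t0 (le_lt_trans tS ST).
Qed.

Lemma continuous_damping_time (S k : R) (z : 'rV[R]_n * R) : 0 < k -> z.2 <= S ->
  damping S k w.2 @[w --> z] --> damping S k z.2.
Proof.
move=> k0 zS; apply: (cvg_comp (fun w : 'rV[R]_n * R => w.2)); first exact: cvg_snd.
exact: damping_continuous.
Qed.

(** Touching from above by [phi * exp (A / r * (|x|^2 - |y|^2))] over the damping
    requires, after division by [phi^3], that three times the rate of the
    damping be at most [8 v (A / r + 8 v)] with [v = (A / r)^2 |y|^2 <= A^2].  Since
    [A / r <= A] and [A <= 1] the latter is at most [72 A^3], less than three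
    times the rate. *)
Lemma upper_barrier (M A r S k : R) (x : 'rV[R]_n) (t : R) :
  0 < M -> (forall y, phi (y, 0) <= M) ->
  0 < A <= 1 -> 1 <= r -> 0 < k -> S < T ->
  72 * A ^+ 3 <= k / (S * (S + k)) ->
  (forall y u, enorm y = r -> 0 < u < T -> phi (y, u) <= M * expR (A * r)) ->
  dot x x <= r ^+ 2 -> 0 < t < S ->
  phi (x, t) * damping S k t <= M * expR (A / r * dot x x).
Proof.
move=> M0 phiM /andP[A0 A1] r1 k0 ST Ak phi_r xr tS.
have r0 : 0 < r by lra.
have S0 : 0 < S by lra.
pose g (z : 'rV[R]_n * R) :=
  phi z * expR (- (A / r) * dot z.1 z.1) * damping S k z.2.
have kr0 : 0 < A / r by rewrite divr_gt0.
have phi0 z : ball_cylinder r S z -> 0 < phi z.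
  by move=> /(ball_cylinderS ST) /phi_gt0.
suff gM : g (x, t) <= M.
  move: gM; rewrite /g /= mulNr expRN mulrAC -ler_pdivlMr ?invr_gt0 ?expR_gt0//.
  by rewrite invrK.
have Kxt : ball_cylinder r S (x, t).
  by split => //=; case/andP: tS => ? ?; rewrite !ltW.
rewrite leNgt; apply/negP => gM.
have [||[y t0] /= [yr /andP[t00 t0S] nearg]] :=
  interior_maximum (ltW r0) _ _ Kxt gM.
- apply/subspace_continuousP => z Kz; have [_ /andP[_ zS]] := Kz.
  apply: cvgM; last by apply: cvg_within_filter; exact: continuous_damping_time.
  apply: cvgM.
    have phiK : {within ball_cylinder r S, continuous phi}.
      exact: continuous_subspaceW (ball_cylinderS ST) phi_cont.
    by have /subspace_continuousP := phiK; apply.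
  apply: cvg_within_filter.
  apply: (cvg_comp (fun w : 'rV[R]_n * R => - (A / r) * dot w.1 w.1) expR).
    by apply: cvgM; [exact: cvg_cst|exact: continuous_sqnorm].
  exact: continuous_expR.
- move=> [y u] Kz; have [/= hy /andP[u0 uS]] := Kz.
  have e1 : expR (- (A / r) * dot y y) <= 1.
    by rewrite -expR0 ler_expR mulNr oppr_le0 mulr_ge0 ?dot_ge0// ltW.
  have d01 : 0 <= damping S k u <= 1 by rewrite damping_ge0// damping_le1.
  have p0 := phi0 _ Kz.
  have gle : phi (y, u) * expR (- (A / r) * dot y y) <= M -> g (y, u) <= M.
    rewrite /g /=; case/andP: d01 => d0 d1; apply: le_trans.
    by rewrite ler_piMr// mulr_ge0 ?expR_ge0// ltW.
  case=> [/= uE|[/= uE|/= yE]].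
  + apply: gle; rewrite uE; apply: le_trans (phiM y).
    by rewrite uE in p0; rewrite ler_piMr// ltW.
  + by rewrite /g /= uE damping_end mulr0 ltW.
  + have [uE|un0] := eqVneq u 0.
      apply: gle; rewrite uE; apply: le_trans (phiM y).
      by rewrite uE in p0; rewrite ler_piMr// ltW.
    apply: gle; rewrite yE mulNr expRN -ler_pdivlMr ?invr_gt0 ?expR_gt0//.
    rewrite invrK expr2 mulrA divfK ?gt_eqF//; apply: phi_r.
      by rewrite /enorm yE sqrtr_sqr ger0_norm ?ltW.
    by rewrite lt_neqAle eq_sym un0 u0 (le_lt_trans uS ST).
- set p := phi (y, t0) in nearg *.
have a0 : 0 < S - t0 by lra.
have p0 : 0 < p.
  by apply: phi0; split; [exact: ltW|rewrite !ltW].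
have touch : \forall z \near nbhs (y, t0),
    phi z <= (p + (p * (A / r)) * (dot z.1 z.1 - dot y y)
               + (2 * p * (A / r) ^+ 2) * (dot z.1 z.1 - dot y y) ^+ 2)
           * (1 - (S - t0) * k / (S - t0 + k) / (S - t0)
                + (S - t0) * k / (S - t0 + k) / (S - z.2)).
  near=> z.
  have zS : z.2 < S.
    by near: z; apply: (cvgr_lt t0) => //; exact: cvg_snd.
  have small : A / r * (dot z.1 z.1 - dot y y) <= 1 / 2.
    apply: ltW; near: z; apply: (cvgr_lt 0); last by rewrite divr_gt0.
    rewrite -[X in _ --> X](mulr0 (A / r)) -[in X in _ --> X](subrr (dot y y)).
    apply: cvgM; first exact: cvg_cst.
    by apply: cvgB; [exact: continuous_sqnorm|exact: cvg_cst].
  have [Kz gz] : ball_cylinder r S z /\ g z <= g (y, t0) by near: z.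
  have es : expR (- (A / r) * dot y y) =
    expR (A / r * (dot z.1 z.1 - dot y y)) * expR (- (A / r) * dot z.1 z.1).
    by rewrite -expRD; congr expR; ring.
  rewrite -damping_ratio// mulrA ler_pdivlMr ?damping_gt0//.
  move: gz; rewrite /g /= -/p es.
  have := expR_quadratic small; have := expR_gt0 (- (A / r) * dot z.1 z.1).
  have := damping_gt0 k0 t0S.
  move: (expR (A / r * _)) (expR (- (A / r) * _)) (damping S k t0)
    (damping S k z.2) => e1 e2 q0 q q00 e20 e1le.
  have -> : phi z * e2 * q = phi z * q * e2 by ring.
  have -> : p * (e1 * e2) * q0 = p * e1 * q0 * e2 by ring.
  rewrite ler_pM2r// => /le_trans; apply; rewrite ler_pM2r//.
  apply: (le_trans (ler_wpM2l (ltW p0) e1le)).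
  by rewrite le_eqVlt; apply/orP; left; apply/eqP; ring.
have Oz : cylinder n T (y, t0) by split => //=; rewrite t00 (lt_trans t0S ST).
have := viscosity_touch_above phi_sol Oz t0S touch; rewrite -/p.
have rate : k / (S * (S + k)) <= k / ((S - t0) * (S - t0 + k)).
  by apply: damping_rate => //; rewrite t00.
have w0 : 0 < k / ((S - t0) * (S - t0 + k)).
  by rewrite divr_gt0// mulr_gt0//; lra.
have -> : (S - t0) * k / (S - t0 + k) / (S - t0) ^+ 2 =
    k / ((S - t0) * (S - t0 + k)).
  by field; apply/andP; split; rewrite gt_eqF//; lra.
move: (k / _) (k / _) Ak rate w0 => w w' Ak rate w0.
set s := dot y y in yr *.
pose v := (A / r) ^+ 2 * s.
have v0 : 0 <= v by rewrite mulr_ge0 ?sqr_ge0 ?dot_ge0.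
have vA : v <= A ^+ 2.
  rewrite /v expr_div_n mulrAC ler_pdivrMr ?exprn_gt0//.
  by rewrite ler_wpM2l ?sqr_ge0 ?ltW.
have kA : A / r <= A by rewrite ler_pdivrMr// ler_peMr// ltW.
have -> : 8 * (p * (A / r)) ^+ 2 * s * (p * (A / r) + 4 * (2 * p * (A / r) ^+ 2) * s)
   = p ^+ 3 * (8 * v * (A / r + 8 * v)) by rewrite /v; ring.
have p3 : 0 < p ^+ 3 by rewrite exprn_gt0.
have -> : 3 * p ^+ 3 * w = p ^+ 3 * (3 * w) by ring.
rewrite ler_pM2l// leNgt => /negP; apply.
have bound : 8 * v * (A / r + 8 * v) <= 72 * A ^+ 3.
  have A3 : 8 * A ^+ 2 * (A + 8 * A ^+ 2) <= 72 * A ^+ 3.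
    have -> : 8 * A ^+ 2 * (A + 8 * A ^+ 2) = A ^+ 3 * (8 + 64 * A) by ring.
    by rewrite [leRHS]mulrC (ler_wpM2l (exprn_ge0 3 (ltW A0)))//; lra.
  apply: le_trans A3; apply: ler_pM; try lra.
by lra.
Unshelve. all: by end_near. Qed.

(** With [a = r^2 - |y|^2], the touching inequality divided by [phi^3] bounds
    three times the rate of the damping by [64 |y|^2 (a - 2 |y|^2) / a^4].  This
    is nonpositive when [a <= 2 |y|^2]; otherwise [|y|^2 < r^2 / 3], hence
    [a > 2 r^2 / 3], and the bound is less than [72 / r^4], where the constant
    24 comes from. *)
Lemma lower_barrier (m r S k : R) (x : 'rV[R]_n) (t : R) :
  0 < m -> (forall y, m <= phi (y, 0)) ->
  0 < r -> 0 < k -> S < T ->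
  24 < r ^+ 4 * (k / (S * (S + k))) ->
  dot x x <= r ^+ 2 -> 0 < t < S ->
  m * (r ^+ 2 - dot x x) ^+ 2 * damping S k t <= r ^+ 4 * phi (x, t).
Proof.
move=> m0 phim r0 k0 ST rk xr tS.
have S0 : 0 < S by lra.
pose g (z : 'rV[R]_n * R) :=
  (r ^+ 2 - dot z.1 z.1) ^+ 2 * damping S k z.2 / phi z.
have phi0 z : ball_cylinder r S z -> 0 < phi z.
  by move=> /(ball_cylinderS ST) /phi_gt0.
have Kxt : ball_cylinder r S (x, t).
  by split => //=; case/andP: tS => ? ?; rewrite !ltW.
have r4 : 0 < r ^+ 4 by rewrite exprn_gt0.
suff gM : g (x, t) <= r ^+ 4 / m.
  move: gM; rewrite /g ler_pdivrMr ?phi0// [leRHS]mulrAC ler_pdivlMr//.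
  by rewrite [leLHS]mulrC mulrA.
rewrite leNgt; apply/negP => gM.
have B0 : 0 < r ^+ 4 / m by rewrite divr_gt0.
have [||[y t0] /= [yr /andP[t00 t0S] nearg]] :=
  interior_maximum (ltW r0) _ _ Kxt gM.
- apply/subspace_continuousP => z Kz; have [_ /andP[_ zS]] := Kz.
  apply: cvgM.
    apply: cvg_within_filter; apply: cvgM; last exact: continuous_damping_time.
    apply: (cvg_comp (fun w : 'rV[R]_n * R => r ^+ 2 - dot w.1 w.1)
      (fun u => u ^+ 2)); last exact: exprn_continuous.
    by apply: cvgB; [exact: cvg_cst|exact: continuous_sqnorm].
  apply: cvgV; first by rewrite gt_eqF// phi0.
  have phiK : {within ball_cylinder r S, continuous phi}.
    exact: continuous_subspaceW (ball_cylinderS ST) phi_cont.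
  by have /subspace_continuousP := phiK; apply.
- move=> [y u] Kz; have [/= hy /andP[u0 uS]] := Kz.
  rewrite /g /= => -[uE|[uE|yE]].
  + have p0 := phi0 _ Kz; rewrite ler_pdivrMr//.
    have pm : m <= phi (y, u) by rewrite uE.
    have q1 : damping S k u <= 1 by exact: damping_le1.
    have q0 : 0 <= damping S k u by exact: damping_ge0.
    have d4 : (r ^+ 2 - dot y y) ^+ 2 <= r ^+ 4.
      have -> : r ^+ 4 = (r ^+ 2) ^+ 2 by rewrite -exprM.
      rewrite ler_sqr ?nnegrE ?sqr_ge0 ?subr_ge0//.
      by rewrite gerBl dot_ge0.
    apply: (@le_trans _ _ (r ^+ 4)).
      by rewrite -[leRHS]mulr1 ler_pM ?sqr_ge0.
    by rewrite -mulrA ler_peMr ?(ltW r4)// mulrC ler_pdivlMr// mul1r.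
  + by rewrite uE damping_end mulr0 mul0r ltW.
  + by rewrite yE subrr expr0n /= !mul0r ltW.
set p := phi (y, t0) in nearg *.
set s := dot y y in yr nearg *.
have a0 : 0 < S - t0 by lra.
have p0 : 0 < p.
  by apply: phi0; split; [exact: ltW|rewrite !ltW].
pose a := r ^+ 2 - s.
have sa0 : 0 < a by rewrite subr_gt0.
have touch : \forall z \near nbhs (y, t0),
    (p + (- 2 * p / a) * (dot z.1 z.1 - s)
               + (p / a ^+ 2) * (dot z.1 z.1 - s) ^+ 2)
           * (1 - - ((S - t0 + k) / (S - t0) * k) / (S + k - t0)
                + - ((S - t0 + k) / (S - t0) * k) / (S + k - z.2)) <= phi z.
  near=> z.
  have zS : z.2 < S.
    by near: z; apply: (cvgr_lt t0) => //; exact: cvg_snd.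
  have [Kz gz] : ball_cylinder r S z /\ g z <= g (y, t0) by near: z.
  rewrite -damping_ratioV//.
  move: gz; rewrite /g /= -/p -/s -/a.
  have := damping_gt0 k0 t0S; have := phi0 _ Kz.
  move: (damping S k t0) (damping S k z.2) (phi z) => q0 q f f0 q00.
  rewrite ler_pdivrMr// => H.
  rewrite mulrA ler_pdivrMr//.
  have -> : p + - 2 * p / a * (dot z.1 z.1 - s) +
     p / a ^+ 2 * (dot z.1 z.1 - s) ^+ 2 =
     (r ^+ 2 - dot z.1 z.1) ^+ 2 * (p / a ^+ 2).
    by rewrite /a; field; rewrite gt_eqF.
  rewrite mulrAC mulrA ler_pdivrMr ?exprn_gt0//.
  rewrite -ler_pdivlMr//; apply: le_trans H _.
  by rewrite le_eqVlt; apply/orP; left; apply/eqP; ring.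
have Oz : cylinder n T (y, t0) by split => //=; rewrite t00 (lt_trans t0S ST).
have t0c : t0 < S + k by lra.
have := viscosity_touch_below phi_sol Oz t0c touch; rewrite -/p -/s.
have rate : k / (S * (S + k)) <= k / ((S - t0) * (S - t0 + k)).
  by apply: damping_rate => //; rewrite t00.
have -> : - ((S - t0 + k) / (S - t0) * k) / (S + k - t0) ^+ 2 =
    - (k / ((S - t0) * (S - t0 + k))).
  by field; do ?[apply/andP; split]; rewrite gt_eqF//; lra.
have {rk rate} : 24 < r ^+ 4 * (k / ((S - t0) * (S - t0 + k))).
  by rewrite (lt_le_trans rk)// ler_wpM2l// ltW.
move: (k / _) => w rw.
have -> : 8 * (- 2 * p / a) ^+ 2 * s * (- 2 * p / a + 4 * (p / a ^+ 2) * s) =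
  - (p ^+ 3 * (64 * s * (a - 2 * s) / a ^+ 4)).
  by field; rewrite gt_eqF.
have p3 : 0 < p ^+ 3 by rewrite exprn_gt0.
have -> : 3 * p ^+ 3 * - w = - (p ^+ 3 * (3 * w)) by ring.
rewrite lerN2 ler_pM2l// ler_pdivlMr ?exprn_gt0// leNgt => /negP; apply.
have s0 : 0 <= s by exact: dot_ge0.
have w0 : 0 < w by rewrite -(pmulr_rgt0 _ r4); lra.
have a4 : 0 < a ^+ 4 by rewrite exprn_gt0.
(* The barrier is infinity-subharmonic where a <= 2 |y|^2, near the sphere. *)
have [as2|as2] := leP a (2 * s).
  apply: (@le_lt_trans _ _ 0); last by rewrite !mulr_gt0.
  by rewrite mulr_ge0_le0 ?mulr_ge0// subr_le0.
have aN : 2 / 3 * r ^+ 2 <= a by rewrite /a in as2 *; lra.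
have aw : 32 / 3 < a ^+ 2 * w.
  have : (2 / 3 * r ^+ 2) ^+ 2 <= a ^+ 2.
    have b0 : 0 <= 2 / 3 * r ^+ 2 by rewrite mulr_ge0 ?sqr_ge0//; lra.
    by rewrite ler_sqr // nnegrE (ltW sa0).
  move=> /(ler_wpM2r (ltW w0)).
  have -> : (2 / 3 * r ^+ 2) ^+ 2 * w = 4 / 9 * (r ^+ 4 * w) by field.
  by lra.
have -> : 3 * w * a ^+ 4 = 3 * (a ^+ 2 * w) * a * a by ring.
apply: (@le_lt_trans _ _ (64 * s * a)).
  by rewrite ler_wpM2l ?mulr_ge0//; lra.
rewrite ltr_pM2r//.
apply: (@lt_trans _ _ (32 * a)); first by lra.
by rewrite ltr_pM2r//; lra.
Unshelve. all: by end_near. Qed.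

(** The parameter [A] is fixed by the damping rate before [r] is sent to
    infinity, which is why an arbitrarily small linear rate of growth is needed:
    the half of [A r] that [h] leaves free also makes up for [M < 1]. *)
Lemma upper_bound (M : R) (h : R -> R -> R) :
  0 < M -> (forall y, phi (y, 0) <= M) ->
  (forall eps, 0 < eps -> exists r0, forall r t, r0 <= r -> 0 < t < T ->
    h r t <= eps * r) ->
  (forall x t, 0 < t < T -> phi (x, t) <= expR (h (enorm x) t)) ->
  forall x t, 0 < t < T -> phi (x, t) <= M.
Proof.
move=> M0 phiM hsub phi_le x t /andP[t0 tT].
pose S := (t + T) / 2.
have tS : t < S by rewrite /S; lra.
have ST : S < T by rewrite /S; lra.
have S0 : 0 < S by lra.
apply: (@le_of_damped_le R (S - t)); [lra|exact: ltW|] => k k0.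
pose w := k / (S * (S + k)).
have w0 : 0 < w by rewrite divr_gt0// mulr_gt0//; lra.
pose A := Num.min 1 (w / 72).
have A0 : 0 < A by rewrite lt_min ltr01 divr_gt0.
have A1 : A <= 1 by rewrite ge_min lexx.
have Aw : 72 * A ^+ 3 <= w.
  have : A <= w / 72 by rewrite ge_min lexx orbT.
  rewrite ler_pdivlMr// mulrC; apply: le_trans.
  by rewrite ler_pM2l// -[leRHS]mulr1 exprS ler_pM2l// exprn_ile1// ltW.
have [r0 hr0] := hsub (A / 2) (divr_gt0 A0 (ltr0n _ 2)).
pose s := dot x x; have s0 : 0 <= s by exact: dot_ge0.
apply: (@le_of_asymptotic_le R _ (phi (x, t) * damping S k t * s) _
  (Num.max r0 (Num.max 1 (Num.max s (2 / (A * M)))))) => r.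
rewrite !ge_max => /and4P[rr0 r1 rs rM] rgt0.
have phi_r y u : enorm y = r -> 0 < u < T -> phi (y, u) <= M * expR (A * r).
  move=> yr uT; apply: le_trans (phi_le _ _ uT) _; rewrite yr.
  have hr : h r u <= A * r / 2 by rewrite mulrAC hr0.
  apply: (@le_trans _ _ (expR (A * r / 2))); first by rewrite ler_expR.
  have -> : expR (A * r) = expR (A * r / 2) * expR (A * r / 2).
    by rewrite -expRD; congr expR; field.
  rewrite mulrA ler_peMl ?expR_ge0//.
  rewrite mulrC -ler_pdivrMr// div1r.
  apply: le_trans (expR_ge1Dx _).
  move: rM; rewrite ler_pdivrMr ?mulr_gt0// => rM.
  have : M^-1 * (r * (A * M)) = r * A by field; rewrite gt_eqF.
  have := ler_wpM2l (_ : 0 <= M^-1) rM; rewrite invr_ge0 ltW// => /(_ isT).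
  by lra.
have xr : dot x x <= r ^+ 2.
  by rewrite -/s (le_trans rs)// expr2 ler_peMr// ltW.
have tS' : 0 < t < S by rewrite t0.
have A01 : 0 < A <= 1 by rewrite A0.
have := upper_barrier M0 phiM A01 r1 k0 ST Aw phi_r xr tS'.
set Y := phi (x, t) * _ => H.
have Y0 : 0 <= Y.
  by rewrite mulr_ge0 ?damping_ge0 ?ltW// phi_gt0//; left; split => //=; rewrite t0.
rewrite -[leRHS]mulr1 -(expR0) -(subrr (A / r * s)) expRD mulrA.
apply: (@le_trans _ _ (Y * expR (- (A / r * s)))).
  have -> : Y - Y * s / r = Y * (1 + - (s / r)) by ring.
  rewrite ler_wpM2l//; apply: le_trans (expR_ge1Dx _).
  rewrite lerD2l lerN2 mulrAC ler_wpM2r ?invr_ge0 ?(ltW rgt0)//.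
  by rewrite ler_piMl.
by rewrite ler_wpM2r ?expR_ge0.
Qed.

Lemma lower_bound (m : R) :
  0 < m -> (forall y, m <= phi (y, 0)) ->
  forall x t, 0 < t < T -> m <= phi (x, t).
Proof.
move=> m0 phim x t /andP[t0 tT].
pose S := (t + T) / 2.
have tS : t < S by rewrite /S; lra.
have ST : S < T by rewrite /S; lra.
have S0 : 0 < S by lra.
have p0 : 0 <= phi (x, t).
  by rewrite ltW// phi_gt0//; left; split => //=; rewrite t0.
apply: (@le_of_damped_le R (S - t)); [lra|by []|] => k k0.
pose w := k / (S * (S + k)).
have w0 : 0 < w by rewrite divr_gt0// mulr_gt0//; lra.
pose s := dot x x; have s0 : 0 <= s by exact: dot_ge0.
apply: (@le_of_asymptotic_le R _ (m * damping S k t * (2 * s)) _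
  (Num.max (24 / w + 1) (Num.max 1 s))) => r.
rewrite !ge_max => /and3P[rw r1 rs] rgt0.
have rr2 : r <= r ^+ 2 by rewrite expr2 ler_peMr// ltW.
have rr4 : r ^+ 2 <= r ^+ 4.
  have -> : r ^+ 4 = r ^+ 2 * r ^+ 2 by ring.
  by rewrite ler_peMr ?sqr_ge0//; lra.
have r4w : 24 < r ^+ 4 * (k / (S * (S + k))).
  by rewrite -/w -ltr_pdivrMr//; lra.
have xr : dot x x <= r ^+ 2 by rewrite (le_trans rs).
have tS' : 0 < t < S by rewrite t0.
have := lower_barrier m0 phim rgt0 k0 ST r4w xr tS'.
rewrite -/s; have q0 : 0 < damping S k t by exact: damping_gt0.
rewrite -/(damping S k t); move: (damping S k t) q0 => q q0 H.
rewrite -(@ler_pM2l _ (r ^+ 4)) ?exprn_gt0//; apply: le_trans H.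
have -> : r ^+ 4 * (m * q - m * q * (2 * s) / r) =
  m * q * (r ^+ 4 - 2 * s * r ^+ 3) by field; rewrite gt_eqF.
have -> : m * (r ^+ 2 - s) ^+ 2 * q = m * q * (r ^+ 2 - s) ^+ 2 by ring.
rewrite ler_pM2l ?mulr_gt0//.
have -> : (r ^+ 2 - s) ^+ 2 = r ^+ 4 - 2 * s * r ^+ 2 + s ^+ 2 by ring.
have rr3 : r ^+ 2 <= r ^+ 3 by rewrite [leRHS]exprS ler_peMl ?sqr_ge0.
have := ler_wpM2l s0 rr3; have := sqr_ge0 s; lra.
Qed.
End barriers.

(** * The maximum principle *)

Theorem lemma4p2 (R : realType) (n : nat) (hn : (2 <= n)%N) (T : R)
  (hT : 0 < T)
  (f : 'rV[R]_n -> R) (f_gt0 : forall x, 0 < f x)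
  (f_cont : continuous f) (f_bounded : exists M : R, forall x, `|f x| <= M)
  (phi : 'rV[R]_n * R -> R)
  (phi_cont : {within cylinder0 n T, continuous phi})
  (phi_gt0 : forall z, cylinder0 n T z -> 0 < phi z)
  (phi_sol : viscosity_solution (cylinder n T) phi)
  (phi_init : forall x, phi (x, 0) = f x)
  (h : R -> R -> R)
  (h_gt0 : forall r t : R, 0 <= r -> 0 < t < T -> 0 < h r t)
  (h_growth :
     (ereal_sup [set (h r t)%:E | t in [set t : R | (0 < t < T)%R]] * (r^-1)%:E)%E
       @[r --> +oo%R] --> 0%E)
  (phi_le : forall (x : 'rV[R]_n) (t : R), 0 < t < T -> phi (x, t) <= expR (h (enorm x) t)) :
  forall (x : 'rV[R]_n) (t : R), 0 < t < T ->
    inf (range f) <= phi (x, t) <= sup (range f).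
Proof.
have f_sup : has_sup (range f).
  split; first by exists (f 0), 0.
  have [K fK] := f_bounded; exists K => _ [x _ <-].
  exact: le_trans (ler_norm _) (fK x).
have f_inf : has_inf (range f).
  split; first by exists (f 0), 0.
  by exists 0 => _ [x _ <-]; exact: ltW.
have f_le y : phi (y, 0) <= sup (range f).
  by rewrite phi_init; apply: (ub_le_sup f_sup.2); exists y.
have f_ge y : inf (range f) <= phi (y, 0).
  by rewrite phi_init; apply: (ge_inf f_inf.2); exists y.
have sup_gt0 : 0 < sup (range f).
  by apply: lt_le_trans (f_le 0); rewrite phi_init.
move=> x t tT; apply/andP; split; last first.
  exact: (upper_bound phi_cont phi_gt0 phi_sol sup_gt0 f_le
    (sublinear_bound h_growth) phi_le).
(* The infimum of f may be 0; then positivity of phi is the claim. *)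
have [inf_gt0|inf_le0] := ltP 0 (inf (range f)).
  exact: (lower_bound phi_cont phi_gt0 phi_sol inf_gt0 f_ge).
apply: le_trans inf_le0 (ltW _); apply: phi_gt0.
by left; split.
Qed.
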